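(* Let $\alpha, F$ be positive integers with $F>4\alpha-6$. Then there is a bijection between the set of numerical semigroups with Frobenius number $F$ and type $F-\alpha$ and the set of numerical sets $T$ for which $g(T)+g(A(T))=\alpha$.
   Context: $\mathbb{N}=\{0,1,2,\dots\}$. A numerical set is a subset $T\subseteq\mathbb{N}$ containing $0$ with finite complement in $\mathbb{N}$; a numerical semigroup is a numerical set closed under addition. Elements of $\mathbb{N}\setminus T$ are the gaps of $T$; the genus $g(T)$ is the number of gaps; for $T\neq\mathbb{N}$ the Frobenius number $F(T)$ is the largest gap. The numerical semigroup associated to a numerical set $T$ is $A(T)=\{x\in\mathbb{N}\mid x+y\in T\text{ for all }y\in T\}$. For a numerical semigroup $S$, $PF(S)=\{x\in\mathbb{N}\setminus S \mid x+s\in S \text{ for all } s\in S\setminus\{0\}\}$ and the type is $t(S)=|PF(S)|$. *)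

(* Defs.v *)
From mathcomp Require Import all_boot all_order all_algebra.
From mathcomp Require Import finmap.
From mathcomp Require Import boolp classical_sets functions cardinality.

Set Implicit Arguments.
Unset Strict Implicit.
Unset Printing Implicit Defensive.

Local Open Scope classical_set_scope.
Local Open Scope nat_scope.

Definition gaps (T : set nat) : set nat := ~` T.

Definition numerical_set (T : set nat) : Prop := T 0 /\ finite_set (gaps T).

Definition numerical_semigroup (S : set nat) : Prop :=
  numerical_set S /\ forall x y, S x -> S y -> S (x + y).

(* [fset_set A] is a junk value when [A] is infinite; [genus] and [sgtype] are
   meaningful for sets with finite complement. *)
Definition genus (T : set nat) : nat := #|` fset_set (gaps T)|.

(* A relation rather than a function, since [setT] has no Frobenius number. *)
Definition is_frobenius (T : set nat) (F : nat) : Prop :=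
  gaps T F /\ forall x, gaps T x -> x <= F.

Definition assoc_semigroup (T : set nat) : set nat :=
  [set x | forall y, T y -> T (x + y)].

Definition pseudo_frobenius (S : set nat) : set nat :=
  [set x | gaps S x /\ forall s, S s -> s <> 0 -> S (x + s)].

Definition sgtype (S : set nat) : nat := #|` fset_set (pseudo_frobenius S)|.

(* Main.v *)
Require Import Defs.
From mathcomp Require Import all_boot all_order all_algebra.
From mathcomp Require Import finmap.
From mathcomp Require Import boolp classical_sets functions cardinality.
From mathcomp Require Import zify.

(** For a semigroup [S] with Frobenius number [F], let [T] be the numerical set
    whose gaps are the [F - s] with [s] in [S] and [0 < s < F].  Then [A(T)] is
    the union of [S] and [PF(S)], so [g(T) + g(A(T)) = F - t(S)], and [S] is
    recovered from [T] by reflecting its gaps again.  Conversely, reflecting the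
    gaps of a numerical set [T] gives a set closed under addition as soon as any
    two gaps of [T] have sum less than [F].  If [f = F(T)], then [f] is also the
    largest gap of the semigroup [A(T)], which cannot contain both [x] and
    [f - x]; hence [f + 1 <= 2 g(A(T)) <= 2 (alpha - 1)] and
    [2 f <= 4 alpha - 6 < F]. *)

Set Implicit Arguments.
Unset Strict Implicit.
Unset Printing Implicit Defensive.

Local Open Scope classical_set_scope.
Local Open Scope nat_scope.

(** Cardinalities become sums over a common index range, which can then be reversed, added and
    compared term by term. *)
Lemma card_fset_set_sum (A : set nat) n : (forall x, A x -> x < n) ->
  #|` fset_set A| = \sum_(i < n) `[< A i >].
Proof.
move=> An.
have -> : fset_set A = [fset x in [seq i <- iota 0 n | `[< A i >]]]%fset.
  have finA : finite_set A by apply: sub_finite_set (finite_II n) => x /An.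
  apply/fsetP => x; rewrite in_fset_set // inE /= mem_filter mem_iota add0n leq0n /=.
  apply/idP/andP => [/set_mem Ax|[/asboolP Ax _]]; last exact/mem_set.
  by split; [exact/asboolP|exact: An].
rewrite card_fseq undup_id ?filter_uniq ?iota_uniq // size_filter -sum1_count.
by rewrite big_mkcond -[X in iota _ X]subn0 big_mkord;
  apply: eq_bigr => i _; case: asbool.
Qed.

(** The bound [x < F] matters: for [x >= F] truncated subtraction gives [F - x = 0], which lies in
    every numerical set. *)
Definition gap_reflection (F : nat) (S : set nat) : set nat :=
  ~` [set x | 0 < x < F /\ S (F - x)].

Lemma gaps_gap_reflection F S :
  gaps (gap_reflection F S) = [set x | 0 < x < F /\ S (F - x)].
Proof. exact: setCK. Qed.

Lemma numerical_set_gap_reflection F S : numerical_set (gap_reflection F S).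
Proof.
split; first by case.
rewrite gaps_gap_reflection.
by apply: sub_finite_set (finite_II F) => x [/andP[]].
Qed.

(** The relation [x + y + s = F] exchanges the two kinds of witness: [y] in the reflection with
    [x + y] a gap of it, and nonzero [s] in [S] with [x + s] outside [S]. *)
Lemma gaps_assoc_gap_reflection F S :
  numerical_semigroup S -> is_frobenius S F ->
  gaps (assoc_semigroup (gap_reflection F S)) = gaps S `\` pseudo_frobenius S.
Proof.
move=> [[S0 _] SD] [nSF leF]; apply/seteqP; split=> x.
- move=> /existsNP[y /not_implyP[Ty nTxy]].
  have [xyF Sxy] : 0 < x + y < F /\ S (F - (x + y)) by exact: contrapT.
  have s0 : F - (x + y) <> 0 by lia.
  have nS : ~ S (x + (F - (x + y))).
    have [y0|y0] := posnP y; first by have -> : x + (F - (x + y)) = F by lia.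
    move=> Sx; apply: Ty; split; first lia.
    by have -> : F - y = x + (F - (x + y)) by lia.
  split; last by move=> [_ /(_ _ Sxy s0)].
  by move=> Sx; apply: nS; exact: SD.
- move=> [nSx nPF] Ax; apply: nPF; split=> // s Ss s0; apply: contrapT => nSxs.
  have xsF := leF _ nSxs.
  have x0 : x <> 0 by move=> x0; apply: nSx; rewrite x0.
  have /Ax : gap_reflection F S (F - (x + s)).
    move=> [h]; have -> : F - (F - (x + s)) = x + s by lia.
    exact: nSxs.
  apply; split; first lia.
  by have -> : F - (x + (F - (x + s))) = s by lia.
Qed.

Lemma genus_gap_reflection F S :
  numerical_semigroup S -> is_frobenius S F ->
  genus (gap_reflection F S) + genus (assoc_semigroup (gap_reflection F S))
    + sgtype S = F.
Proof.
move=> semiS frobS; have [[S0 _] _] := semiS; have [nSF leF] := frobS.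
rewrite /genus gaps_assoc_gap_reflection // gaps_gap_reflection /sgtype.
rewrite !(@card_fset_set_sum _ F.+1).
- rewrite (reindex_inj rev_ord_inj) -!big_split /=.
  (* With the first sum reversed, each [i] from [1] to [F] is counted once: through the reflected
     gap [F - i] if [i] is in [S], and otherwise according to whether it is pseudo-Frobenius. The
     index [0] is never counted. *)
  rewrite (eq_bigr (fun i : 'I_F.+1 => nat_of_bool (0 < i))).
    by rewrite big_ord_recl /= sum_nat_const card_ord muln1.
  move=> [i iF] _ /=; rewrite subSS subKn //.
  have [Si|nSi] := pselect (S i); last first.
    have i0 : 0 < i by case: i nSi {iF}.
    rewrite i0 (asboolF (P := _ /\ S i)); last by case.
    have [Pi|nPi] := pselect (pseudo_frobenius S i).
      by rewrite (asboolT Pi) (asboolF (P := gaps S i /\ _)) //; case.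
    by rewrite (asboolF nPi) (asboolT (P := gaps S i /\ _)).
  rewrite (asboolF (P := pseudo_frobenius S i)); last by case.
  rewrite (asboolF (P := gaps S i /\ _)); last by case.
  have iF' : i <> F by move=> iF'; apply: nSF; rewrite -iF'.
  rewrite !addn0; congr nat_of_bool; apply/asboolP/idP; first by case; lia.
  by move=> i0; split=> //; lia.
- by move=> x [/leF].
- by move=> x [/leF].
- by move=> x [h _]; lia.
Qed.

(** This yields injectivity: the right-hand side depends on [S] only through its reflection. *)
Lemma mem_gap_reflection_inv F S x : numerical_set S -> is_frobenius S F ->
  S x <-> x = 0 \/ F < x \/ 0 < x < F /\ gaps (gap_reflection F S) (F - x).
Proof.
move=> [S0 _] [nSF leF]; rewrite gaps_gap_reflection; split=> [Sx|].
  have xF : x <> F by move=> xF; apply: nSF; rewrite -xF.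
  have [->|x0] := posnP x; first by left.
  have [Fx|xF'] := ltnP F x; first by right; left.
  right; right; do 2 (split; first lia).
  by rewrite subKn.
case=> [->//|[Fx|[h []]]].
  by apply: contrapT => /leF; lia.
by move=> _; rewrite subKn //; lia.
Qed.

Lemma gap_bound_assoc T f :
  numerical_set T -> is_frobenius T f -> f < 2 * genus (assoc_semigroup T).
Proof.
move=> [T0 _] [nTf leF]; rewrite /genus (@card_fset_set_sum _ f.+1); last first.
  move=> x nAx; rewrite ltnS leqNgt; apply/negP => fx; apply: nAx => y _.
  by apply: contrapT => /leF; lia.
rewrite mul2n -addnn [X in _ < _ + X](reindex_inj rev_ord_inj) -big_split /=.
rewrite -[X in X <= _](card_ord f.+1) -sum1_card; apply: leq_sum => -[i iF] _ /=.
rewrite subSS.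
have [Ai|nAi] := pselect (assoc_semigroup T i); last first.
  by rewrite (asboolT (P := gaps _ i)).
(* If [i] and [f - i] were both in the associated semigroup, then [f - i = (f - i) + 0] would be in
   [T], hence also [i + (f - i) = f]. *)
rewrite addnC (asboolT (P := gaps _ (f - i))) // => Af; apply: nTf.
have Tf : T (f - i) by rewrite -[f - i]addn0; exact: Af.
by have := Ai _ Tf; rewrite subnKC.
Qed.

Lemma genus_gt0 T x : numerical_set T -> gaps T x -> 0 < genus T.
Proof.
move=> [_ finT] Tx; rewrite /genus cardfs_gt0; apply/fset0Pn; exists x.
by rewrite in_fset_set // mem_set.
Qed.

Lemma is_frobenius_exists T : numerical_set T -> T <> setT ->
  exists f, is_frobenius T f.
Proof.
move=> [_ finT] nT.
have [x Tx] : exists x, gaps T x.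
  apply: contrapT => h; apply: nT.
  by apply/seteqP; split=> // y _; apply: contrapT => Ty; apply: h; exists y.
have exP : exists n, `[< gaps T n >] by exists x; exact/asboolP.
(* The sum of all gaps serves as a crude upper bound for each gap. *)
have ubP n : `[< gaps T n >] -> n <= \sum_(i <- fset_set (gaps T)) i.
  move=> /asboolP Tn; rewrite (big_fsetD1 n) ?leq_addr //=.
  by rewrite in_fset_set // mem_set.
have [f /asboolP Tf fmax] := ex_maxnP exP ubP.
by exists f; split=> // y Ty; apply: fmax; exact/asboolP.
Qed.

Lemma gap_reflection_surj F T f :
  numerical_set T -> is_frobenius T f -> 2 * f < F ->
  exists S, [/\ numerical_semigroup S, is_frobenius S F & gap_reflection F S = T].
Proof.
move=> [T0 finT] [nTf leF] fF.
have f0 : f <> 0 by move=> f0; apply: nTf; rewrite f0.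
exists [set x | x = 0 \/ F < x \/ 0 < x < F /\ gaps T (F - x)]; split.
- split; first split=> /=; first by left.
    apply: sub_finite_set (finite_II F.+1) => x nSx /=.
    by rewrite ltnS leqNgt; apply/negP => Fx; apply: nSx; right; left.
  move=> x y [->//|Sx] [->|Sy]; first by rewrite addn0; right.
  (* Nonzero elements are at least [F - f], so two of them add up to at least
     [2 * F - 2 * f > F]. *)
  right; left.
  case: Sx => [Fx|[_ /leF ?]]; first lia.
  case: Sy => [Fy|[_ /leF ?]]; lia.
- split; first by case=> [|[|[]]]; lia.
  by move=> x nSx; rewrite leqNgt; apply/negP => Fx; apply: nSx; right; left.
- apply: setC_inj; rewrite -/(gaps _) gaps_gap_reflection; apply/seteqP; split=> x /=.
    move=> [h [|[|[_]]]]; [lia|lia|].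
    by rewrite subKn //; lia.
  move=> Tx; have xf := leF _ Tx.
  have x0 : x <> 0 by move=> x0; apply: Tx; rewrite x0.
  split; first lia.
  right; right; split; first lia.
  by rewrite subKn //; lia.
Qed.

Theorem theorem3p2 (alpha F : nat) (alpha_gt0 : (0 < alpha)%N) (F_gt0 : (0 < F)%N)
    (F_large : (4 * alpha%:Z - 6 < F%:Z)%R) :
  exists f : set nat -> set nat,
    set_bij
      [set S | numerical_semigroup S /\ is_frobenius S F /\
               ((sgtype S)%:Z = F%:Z - alpha%:Z)%R]%classic
      [set T | numerical_set T /\
               (genus T + genus (assoc_semigroup T))%N = alpha]%classic
      f.
Proof.
exists (gap_reflection F); split.
- move=> S [semiS [frobS typeS]]; split; first exact: numerical_set_gap_reflection.
  by have := genus_gap_reflection semiS frobS; lia.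
- move=> S S' /set_mem[[numS _] [frobS _]] /set_mem[[numS' _] [frobS' _]] eqT.
  apply/seteqP; split=> x.
    by move/(mem_gap_reflection_inv _ numS frobS); rewrite eqT => ?;
      apply/(mem_gap_reflection_inv _ numS' frobS').
  by move/(mem_gap_reflection_inv _ numS' frobS'); rewrite -eqT => ?;
    apply/(mem_gap_reflection_inv _ numS frobS).
- move=> T [numT genT].
  have [f frobT] : exists f, is_frobenius T f.
    (* If [T] had no gaps, both genera would vanish, contradicting [0 < alpha]. *)
    apply: is_frobenius_exists => // TE; move: genT alpha_gt0.
    have -> : assoc_semigroup T = setT by rewrite TE; apply/seteqP; split.
    by rewrite TE /genus /gaps setCT fset_set0 cardfs0 => <-.
  have fA := gap_bound_assoc numT frobT.
  have gT := genus_gt0 numT frobT.1.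
  have [|S [semiS frobS ST]] := @gap_reflection_surj F T f numT frobT; first lia.
  exists S => //; split=> //; split=> //.
  by have := genus_gap_reflection semiS frobS; rewrite ST; lia.
Qed.
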